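(* Consider a consistent collection $\mu_\bullet=(\mu_u)_{u\in\mathcal{U}}$ of finite-dimensional distributions. Then there is a probability measure $P$ on $\sigma(\mathring{\mathscr{C}})$ such that $$P(\{\mathring{X}_u\in A\})=\mu_u(A)\quad\text{for all }u\in\mathcal{U},\ A\subseteq\mathcal{X}_u$$ if and only if $\mu_\bullet$ is regular; if this is the case, then this probability measure is unique.
   Context: $\mathcal{X}$ is a non-empty countable set (of states), $\mathbb{T}$ is an infinite subset of $\mathbb{R}$ (the time axis), and $\mathcal{T}$ is a non-empty subset of $\mathbb{T}$. $\mathbb{N}=\{1,2,\dots\}$ and $\mathbb{R}_{>0}$ is the set of strictly positive reals. Tuples: for any non-empty $\mathcal{S}\subseteq\mathbb{T}$, $\mathcal{U}_{\mathcal{S}}$ is the set of all non-empty finite tuples $(t_1,\dots,t_n)$ of elements of $\mathcal{S}$ with $t_1<\cdots<t_n$; $\mathcal{U}:=\mathcal{U}_{\mathcal{T}}$. For $u,v\in\mathcal{U}_{\mathbb{T}}$, $u\sqsubseteq v$ means that every time point in $u$ is also in $v$. For $u=(t_1,\dots,t_n)$, $\mathcal{X}_u$ is the set of all $n$-tuples of states $x_u=(x_{t_1},\dots,x_{t_n})$ indexed by the time points in $u$; if $v\sqsubseteq u$, $x_v\in\mathcal{X}_v$ consists of the components of $x_u$ with index in $v$. For a map $\omega$ on $\mathbb{T}$, $\omega(u):=(\omega(t_1),\dots,\omega(t_n))$. Limit points: for $\mathcal{S}\subseteq\mathbb{R}$, $\mathrm{rlims}(\mathcal{S})$ (resp. $\mathrm{llims}(\mathcal{S})$)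 is the set of all $t\in\mathbb{R}$ such that $(t,t+\delta)\cap\mathcal{S}\neq\emptyset$ (resp. $(t-\delta,t)\cap\mathcal{S}\neq\emptyset$) for all $\delta\in\mathbb{R}_{>0}$. $\lim_{\mathcal{S}\ni r\searrow t}$ denotes the limit as $r\to t$ with $r\in\mathcal{S}$, $r>t$ ($t\in\mathrm{rlims}(\mathcal{S})$). Càdlàg paths: $\mathring{\Omega}$ is the set of all $\omega:\mathbb{T}\to\mathcal{X}$ such that: for every $t\in\mathrm{llims}(\mathbb{T})$ there are $\delta\in\mathbb{R}_{>0}$ and $x\in\mathcal{X}$ with $\omega(s)=x$ for all $s\in\mathbb{T}\cap(t-\delta,t)$; for every $t\in\mathrm{rlims}(\mathbb{T})$ there are $\delta\in\mathbb{R}_{>0}$ and $x\in\mathcal{X}$ with $\omega(r)=x$ for all $r\in\mathbb{T}\cap(t,t+\delta)$; and for every $t\in\mathbb{T}\cap\mathrm{rlims}(\mathbb{T})$ this right-sided limit $x$ equals $\omega(t)$. Cylinder events: for $u\in\mathcal{U}$ and $A\subseteq\mathcal{X}_u$, $\{\mathring{X}_u\in A\}:=\{\omega\in\mathring{\Omega}:\omega(u)\in A\}$. $\mathring{\mathscr{C}}:=\{\{\mathring{X}_u\in A\}:u\in\mathcal{U},A\subseteq\mathcal{X}_u\}$ is an algebra, and $\sigma(\mathring{\mathscr{C}})$ is the generated $\sigma$-algebra. A collection of finite-dimensional distributions is a family $\mu_\bullet=(\mu_u)_{u\in\mathcal{U}}$ where each $\mu_u$ is a (countably additive) probability measure on the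 power set of $\mathcal{X}_u$. It is consistent if $\mu_u(A)=\mu_v(\{x_v\in\mathcal{X}_v:x_u\in A\})$ for all $u\sqsubseteq v$ in $\mathcal{U}$ and $A\subseteq\mathcal{X}_u$. Number of jumps: for $u=(t_1,\dots,t_n)$ and $x_u\in\mathcal{X}_u$, $\hat\eta_u(x_u)$ is the number of $k\in\{2,\dots,n\}$ with $x_{t_{k-1}}\neq x_{t_k}$. Regularity: $\mu_\bullet$ is regular if (R1) for all $t\in\mathrm{rlims}(\mathcal{T})\cap\mathcal{T}$, $\lim_{\mathcal{T}\ni r\searrow t}\mu_{(t,r)}(\{(x_t,x_r):x_t=x_r\})=1$; and (R2) for all $n\in\mathbb{N}$ such that $[-n,n]\cap\mathcal{T}\neq\emptyset$, $\lim_{k\to+\infty}\sup\{\mu_u(\{x_u\in\mathcal{X}_u:\hat\eta_u(x_u)\geq k\}):u\in\mathcal{U}_{[-n,n]\cap\mathcal{T}}\}=0$. *)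

(* Defs.v *)
From HB Require Import structures.
From mathcomp Require Import all_boot all_order all_algebra.
From mathcomp Require Import all_classical all_reals all_analysis.
Set Implicit Arguments.
Unset Strict Implicit.
Unset Printing Implicit Defensive.
Import Order.TTheory GRing.Theory Num.Theory.
Import numFieldNormedType.Exports.
Local Open Scope classical_set_scope.
Local Open Scope ring_scope.

Definition rlims {R : realType} (S : set R) : set R :=
  [set t | forall d, 0 < d -> `]t, t + d[ `&` S !=set0].

Definition llims {R : realType} (S : set R) : set R :=
  [set t | forall d, 0 < d -> `]t - d, t[ `&` S !=set0].

(** The time axis is a set [T] of reals, used as the type of its elements; a
    subset of the time axis is therefore a term of type [set T]. *)

Section Paths.
Context {R : realType} (X : pointedType) (T : set R).

Definition right_lim (w : T -> X) (t : R) (x : X) : Prop :=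
  exists2 d : R, 0 < d & forall r : T, t < val r < t + d -> w r = x.

Definition left_lim (w : T -> X) (t : R) (x : X) : Prop :=
  exists2 d : R, 0 < d & forall s : T, t - d < val s < t -> w s = x.

Definition cadlag : set (T -> X) :=
  [set w | [/\ forall t : R, llims T t -> exists x, left_lim w t x,
               forall t : R, rlims T t -> exists x, right_lim w t x &
               forall t : T, rlims T (val t) -> right_lim w (val t) (w t)]].

Definition paths : Type := cadlag.

HB.instance Definition _ := Choice.copy paths cadlag.

Lemma cst_cadlag (x : X) : (fun=> x) \in cadlag.
Proof. by rewrite inE; split=> *; try exists x; exists 1. Qed.

HB.instance Definition _ :=
  isPointed.Build paths (exist _ (fun=> point) (cst_cadlag point)).

End Paths.

Section States.
Context (X : pointedType) {I : choiceType}.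

(** Tuples of states indexed by the points of the finite sequence [u]. *)
Definition states (u : seq I) : Type := seq_sub u -> X.

HB.instance Definition _ (u : seq I) := Pointed.copy (states u) (seq_sub u -> X).

(** Every set of tuples of states is measurable. *)
HB.instance Definition _ (u : seq I) :=
  @isMeasurable.Build default_measure_display (states u)
    discrete_measurable discrete_measurable0
    discrete_measurableC discrete_measurableU.

Definition restr (u v : seq I) (uv : {subset u <= v}) (x : states v) :
    states u :=
  fun t => x (SeqSub (uv (val t) (valP t))).

(** Counts the positions of [u], except the first one, at which the state
    differs from the state at the preceding position. *)
Definition jumps (u : seq I) (x : states u) : nat :=
  #|[pred t : seq_sub u | [exists s : seq_sub u,
      ((index (val s) u).+1 == index (val t) u) && (x s != x t)]]|.

End States.

Section Grids.
Context {R : realType} {T : set R}.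

(** The non-empty finite tuples of increasing time points in [S]. *)
Definition grid (S : set T) : set (seq T) :=
  [set u | [/\ u != [::], sorted <%R (map val u) & forall t, t \in u -> S t]].

Definition later (S : set T) (t : T) : set T :=
  [set r | S r /\ val t < val r].

(** The filter of [r] tending to [t] with [r] in [S] and [t < r]. *)
Definition later_nbhs (S : set T) (t : T) : set_system (later S t) :=
  filter_from [set d : R | 0 < d]
    (fun d => [set r : later S t | val (val r) < val t + d]).

Arguments later_nbhs : clear implicits.

Lemma later_nbhs_filter (S : set T) (t : T) : Filter (later_nbhs S t).
Proof.
apply: filter_from_filter; first by exists 1 => /=.
move=> d e /= d0 e0; exists (Num.min d e); first by rewrite /= lt_min d0.
move=> r /= rde; split; apply: (lt_le_trans rde);
  by rewrite lerD2l ge_min lexx ?orbT.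
Qed.

Lemma pair_gridP (S : set T) (t : T) (r : later S t) :
  S t -> [:: t; val r] \in grid S.
Proof.
move=> St; have := set_mem (valP r); case=> Sr tr; apply/mem_set; split=> //=.
  by rewrite tr.
by move=> s; rewrite !inE => /orP[] /eqP->.
Qed.

Definition pair_grid (S : set T) (t : T) (St : S t) (r : later S t) : grid S :=
  exist _ [:: t; val r] (pair_gridP r St).

End Grids.

Arguments later_nbhs {R T} S t.

Section Distributions.
Context {R : realType} {X : pointedType} {T : set R} {S : set T}.

Definition observe (u : grid S) (w : paths X T) : states X (val u) :=
  fun t => val w (val t).

Arguments observe : clear implicits.

Definition cylinder (u : grid S) (A : set (states X (val u))) :
    set (paths X T) :=
  [set w | A (observe u w)].

Definition fdds : Type :=
  forall u : grid S, probability (states X (val u)) R.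

Definition consistent (mu : fdds) : Prop :=
  forall (u v : grid S) (uv : {subset val u <= val v})
    (A : set (states X (val u))),
  mu u A = mu v [set x | A (restr uv x)].

Definition agree (t r : T) : set (states X [:: t; r]) :=
  [set x | x (SeqSub (mem_head t [:: r])) =
           x (SeqSub (mem_last t [:: r]))].

Arguments agree : clear implicits.

Definition right_continuous_fdds (mu : fdds) : Prop :=
  forall (t : T) (St : S t), rlims (val @` S) (val t) ->
  mu (pair_grid St r) (agree t (val r)) @[r --> later_nbhs S t] --> 1%E.

Definition window (n : nat) : set T :=
  [set t | - (n%:R : R) <= val t <= n%:R] `&` S.

Definition bounded_jumps (mu : fdds) : Prop :=
  forall n : nat, (0 < n)%N -> window n !=set0 ->
  ereal_sup [set mu u [set x | (k <= jumps x)%N]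
            | u in [set u : grid S | grid (window n) (val u)]]
    @[k --> \oo] --> 0%E.

Definition regular (mu : fdds) : Prop :=
  right_continuous_fdds mu /\ bounded_jumps mu.

End Distributions.

Arguments fdds {R} X {T} S.
Arguments agree {R X T} t r.
Arguments observe {R X T S} u w.

Definition cylinders {R : realType} (X : pointedType) {T : set R}
    (S : set T) : set (set (paths X T)) :=
  [set C | exists (u : grid S) (A : set (states X (val u))), C = cylinder A].

Arguments cylinders {R} X {T} S.

(** Probability measures on the sigma-algebra generated by the cylinder events;
    as functions on all sets of paths their values are meaningful only on
    measurable sets. *)
Definition path_probability {R : realType} (X : pointedType) {T : set R}
    (S : set T) : Type :=
  probability (g_sigma_algebraType (cylinders X S)) R.

Arguments path_probability {R} X {T} S.

Definition extends {R : realType} {X : pointedType} {T : set R} {S : set T}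
    (P : path_probability X S) (mu : fdds X S) : Prop :=
  forall (u : grid S) (A : set (states X (val u))), P (cylinder A) = mu u A.

(* Main.v *)
From HB Require Import structures.
Require Import Defs.
From mathcomp Require Import all_boot all_order all_algebra.
From mathcomp Require Import all_classical all_reals all_analysis.
From mathcomp Require Import lra.

(** Necessity of regularity. If every path lies in only finitely many of the
    events [A_n], then [P A_n] tends to [0]
    ([probability_lim_sup_empty]). A path agrees with its value at [t] shortly
    after [t], which yields the first condition, and it has boundedly many
    jumps on every bounded interval ([cadlag_locally_bounded_changes]), which
    yields the second one. Uniqueness holds because the cylinder events are
    closed under intersections and generate the sigma-algebra.

    Sufficiency. Every tuple of states is observed along some path
    ([observe_surj]), so a consistent [mu] defines a finitely additive content
    [m] on the algebra of cylinder events. By Caratheodory's theorem it remains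
    to see that [m] is countably additive, and for this that no cylinder event
    [C] is covered by cylinder events [F_i] with [\sum_i m (F_i) < m C]
    ([path_avoiding_cover]). Only countably many times [d_0, d_1, ...] matter
    for [C] and the [F_i]. Let [e] be the gap between the two sides. Regularity
    provides further events, of total measure at most [e], such that a sequence
    of paths [w_n] avoiding more and more of them has a limit that is again
    a path ([compactness_events]). A path that avoids these events
    - takes at each [d_j] a value in a finite set fixed in advance;
    - takes the same value at [d_j] as at certain other times of the sequence
      that tend to [d_j] from the right, if [d_j] is a limit of such times;
    - has on each interval [[-l, l]] at most as many jumps as a bound fixed in
      advance.

    Finite additivity gives a path [w_n] in [C] that avoids these events and
    the [F_i] up to stage [n]. Values along [w_n] converge at every [d_j] along
    an ultrafilter, by the first item. The limit function on the [d_j] has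
    boundedly many jumps on bounded intervals, hence one-sided limits, and the
    second item identifies the limit from the right with the value. Such
    a function extends to a path ([path_extending]): where the [d_j] accumulate
    from the right take the limit from the right, and hold the last value
    elsewhere. As membership in [C] and in each [F_i] depends on finitely many
    [d_j], the resulting path is in [C] but in no [F_i]. *)

Set Implicit Arguments.
Unset Strict Implicit.
Unset Printing Implicit Defensive.
Import Order.TTheory GRing.Theory Num.Theory.
Import numFieldNormedType.Exports.
Local Open Scope classical_set_scope.
Local Open Scope ring_scope.

(** * Counting the changes along a sequence *)

Section Changes.
Context {E : eqType}.
Implicit Types (a b : E) (s : seq E).

Definition changes_from a s : nat :=
  count id (pairmap (fun x y => x != y) a s).

Arguments changes_from : simpl never.

Definition changes s : nat := if s is a :: s' then changes_from a s' else 0.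

Lemma changes_from_cons a b s :
  changes_from a (b :: s) = ((a != b) + changes_from b s)%N.
Proof. by []. Qed.

Lemma changes_from_triangle a b s :
  (changes_from a s <= (a != b) + changes_from b s)%N.
Proof.
case: s => [//|c s]; rewrite !changes_from_cons addnA leq_add2r.
by case: (eqVneq a b) => [->|ab] //=; case: eqVneq; case: eqVneq.
Qed.

(** Deleting an entry merges two adjacent pairs, and by the triangle inequality
    for the discrete distance this creates no change. *)
Lemma changes_from_subseq a s1 s2 :
  subseq s1 s2 -> (changes_from a s1 <= changes_from a s2)%N.
Proof.
elim: s2 a s1 => [|y s2 IH] a [|x s1] //=; rewrite (changes_from_cons a y).
case: eqP => [->|_] sub; first by rewrite changes_from_cons leq_add2l IH.
by rewrite (leq_trans (changes_from_triangle a y _))// leq_add2l IH.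
Qed.

Lemma changes_subseq s1 s2 : subseq s1 s2 -> (changes s1 <= changes s2)%N.
Proof.
case: s1 s2 => [|a s1] [|b s2] //=.
case: eqP => [->|_] sub; first exact: changes_from_subseq.
apply: leq_trans (changes_from_subseq b sub).
by rewrite changes_from_cons leq_addl.
Qed.

Lemma changes_cat_ge s1 s2 :
  (changes s1 + changes s2 <= changes (s1 ++ s2))%N.
Proof.
case: s1 => [//|a s1]; rewrite /= /changes_from pairmap_cat count_cat leq_add2l.
by case: s2 => [//|b s2] /=; rewrite leq_addl.
Qed.

(** Only the junction can contribute a further change. *)
Lemma changes_cat_le s1 s2 :
  (changes (s1 ++ s2) <= (changes s1 + changes s2).+1)%N.
Proof.
case: s1 => [|a s1]; first exact: leqnSn.
rewrite /= /changes_from pairmap_cat count_cat -addnS leq_add2l.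
by case: s2 => [//|b s2] /=; case: eqP.
Qed.

Lemma changes_nseq n a : changes (nseq n a) = 0%N.
Proof.
case: n => [//|n] /=; elim: n => [//|n IH].
by rewrite /= changes_from_cons eqxx.
Qed.

Lemma changes_size s : (changes s <= size s)%N.
Proof.
by case: s => [//|a s] /=; rewrite (leq_trans (count_size _ _)) ?size_pairmap.
Qed.

End Changes.

Lemma card_seq_sub (I : choiceType) (u : seq I) (p : pred I) :
  uniq u -> #|[pred t : seq_sub u | p (val t)]| = count p u.
Proof.
move=> uu; rewrite cardE -[in RHS](val_seq_sub_enum uu) count_map -size_filter.
congr size; rewrite /enum_mem unlock /=.
by apply: eq_filter => t; rewrite !inE.
Qed.

(** Along a duplicate-free sequence positions and elements are in bijection,
    so the jumps can be counted on the list of observed states, where they can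
    be handled by induction. *)
Lemma jumps_changes (X : pointedType) (I : choiceType) (f : I -> X)
    (u : seq I) :
  uniq u -> jumps (fun t : seq_sub u => f (val t)) = changes (map f u).
Proof.
move=> uu; pose p t := has (fun s =>
  ((index s u).+1 == index t u) && (f s != f t)) u.
transitivity #|[pred t : seq_sub u | p (val t)]|.
  apply: eq_card => t; rewrite !inE.
  apply/existsP/hasP => [[s /= st]|[s su st]].
    by exists (val s) => //; exact: (valP s).
  by exists (SeqSub su).
rewrite card_seq_sub//.
case: u uu @p => [//|a u] uu p.
have -> : changes (map f (a :: u)) =
    count (fun i => f (nth a (a :: u) i) != f (nth a u i)) (iota 0 (size u)).
  rewrite /= /changes_from -[RHS](count_map _ id); congr count.
  apply: (@eq_from_nth _ false) => [|i].
    by rewrite size_pairmap !size_map size_iota.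
  rewrite size_pairmap size_map => iu.
  rewrite (nth_pairmap (f a)) ?size_map// -map_cons.
  rewrite !(nth_map a) ?size_iota//=; last exact: ltnW.
  by rewrite (nth_map 0%N) ?size_iota// nth_iota.
rewrite -[X in count p X](mkseq_nth a) count_map /=.
(* The first time has no predecessor. *)
have -> /= : p a = false by apply/hasP => -[s _]; rewrite /= eqxx.
rewrite -[1%N]addn0 iotaDl count_map add0n; apply: eq_in_count => i.
rewrite mem_iota add0n => /andP[_ iu] /=.
have ie : index (nth a u i) (a :: u) = i.+1.
  by rewrite -[nth a u i]/(nth a (a :: u) i.+1) index_uniq.
apply/hasP/idP => [[s su]|ne].
  by rewrite ie eqSS => /andP[/eqP <-]; rewrite nth_index.
exists (nth a (a :: u) i); first by rewrite mem_nth// ltnW.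
by rewrite ie eqSS index_uniq ?eqxx// ltnW.
Qed.

(** * One-sided limits along a subset of the time axis *)

Section Times.
Context {R : realType} {T : set R}.
Implicit Types (D : set T) (u v : seq T) (t : R).

Definition increasing u : bool := sorted <%R (map val u).

Lemma increasing_uniq u : increasing u -> uniq u.
Proof. by move/(sorted_uniq lt_trans ltxx); exact: map_uniq. Qed.

Lemma increasing_cat u v : increasing u -> increasing v ->
  (forall s r : T, s \in u -> r \in v -> val s < val r) -> increasing (u ++ v).
Proof.
rewrite /increasing map_cat !(sorted_pairwise lt_trans) pairwise_cat.
move=> -> -> uv; rewrite !andbT.
by apply/allrelP => _ _ /mapP[s su ->] /mapP[r rv ->]; exact: uv.
Qed.

Lemma increasing_filter (p : pred T) u :
  increasing u -> increasing (seq.filter p u).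
Proof.
by apply: subseq_sorted; [exact: lt_trans|exact/map_subseq/filter_subseq].
Qed.

Lemma increasing_split (p : pred T) u :
  (forall s r : T, val s < val r -> p r -> p s) -> increasing u ->
  u = seq.filter p u ++ seq.filter (predC p) u.
Proof.
move=> pdown; elim: u => [//|s u IH] su /=.
have u_inc : increasing u := path_sorted su.
case: ifPn => [_|nps] /=; first by rewrite -IH.
have un r : r \in u -> ~~ p r.
  move=> ru; apply: contra nps; apply: pdown; move: su.
  rewrite /increasing/= (path_sortedE lt_trans) => /andP[/allP + _].
  by apply; apply: map_f.
have -> : seq.filter p u = [::].
  by rewrite (eq_in_filter (a2 := pred0)) ?filter_pred0// => r /un/negbTE.
by congr cons; apply/esym/all_filterP/allP => r /un.
Qed.

Lemma increasing_subseq u v :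
  increasing u -> increasing v -> {subset u <= v} -> subseq u v.
Proof.
move=> iu iv uv; suff -> : u = seq.filter [in u] v by exact: filter_subseq.
apply: (inj_map val_inj); apply: (@lt_sorted_eq _ _ _ _ iu).
  exact: increasing_filter.
move=> r; apply/mapP/mapP => -[s su ->]; exists s => //.
  by rewrite mem_filter /= su uv.
by move: su; rewrite mem_filter => /andP[].
Qed.

Lemma rlims_ex D t d : rlims (val @` D) t -> 0 < d ->
  exists2 r, D r & t < val r < t + d.
Proof.
move=> tD /tD[z []]; rewrite /= in_itv /= => zd [r Dr rz].
by exists r; rewrite // rz.
Qed.

Lemma rlimsPn D t : ~ rlims (val @` D) t ->
  exists2 d, 0 < d & forall r, D r -> ~~ (t < val r < t + d).
Proof.
move=> /existsNP[d] /not_implyP[d0 tD]; exists d => // r Dr.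
apply/negP => tr; apply: tD; exists (val r).
by split; [rewrite /= in_itv|exists r].
Qed.

End Times.

Section Germs.
Context {R : realType} {X : pointedType} {T : set R}.
Implicit Types (D I : set T) (f : T -> X) (x : X).

Definition right_limit D f t x : Prop :=
  exists2 d, 0 < d & forall r, D r -> t < val r < t + d -> f r = x.

Definition left_limit D f t x : Prop :=
  exists2 d, 0 < d & forall r, D r -> t - d < val r < t -> f r = x.

Definition bounded_changes f I : Prop :=
  exists K, forall u, increasing u -> (forall s : T, s \in u -> I s) ->
    (changes (map f u) <= K)%N.

Definition locally_bounded_changes D f : Prop :=
  forall a b, bounded_changes f (D `&` [set t | a <= val t <= b]).

Lemma right_limit_uniq D f t x y : rlims (val @` D) t ->
  right_limit D f t x -> right_limit D f t y -> x = y.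
Proof.
move=> tD [d d0 dx] [e e0 ey].
have de0 : 0 < Num.min d e by rewrite lt_min d0.
have [r Dr /andP[tr]] := rlims_ex tD de0.
rewrite -ltrBlDl lt_min !ltrBlDl => /andP[rd re].
by rewrite -(dx r) ?tr// -(ey r) ?tr.
Qed.

Lemma constant_or_change D f (a b : R) :
  (exists x, forall r, D r -> a < val r < b -> f r = x) \/
  exists r r', [/\ D r, D r', a < val r, val r < val r' < b & f r != f r'].
Proof.
apply: contrapT => /not_orP[nonconstant nochange]; apply: nonconstant.
have [[r0 [Dr0 /andP[ar0 r0b]]]|none] :=
    pselect (exists r, D r /\ a < val r < b); last first.
  by exists point => r Dr ab; case: none; exists r.
exists (f r0) => r Dr /andP[ar rb].
apply/eqP/negPn/negP => ne; apply: nochange.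
case: (ltgtP (val r) (val r0)) => [rr0|r0r|/val_inj rE].
- by exists r, r0; split; rewrite ?rr0.
- by exists r0, r; split; rewrite ?r0r// eq_sym.
- by rewrite rE eqxx in ne.
Qed.

(** Without a limit there is a change in every right neighbourhood of [t].
    Finding the next one closer to [t] each time produces increasing sequences
    of times with arbitrarily many changes. *)
Lemma right_limit_ex D f t :
  locally_bounded_changes D f -> exists x, right_limit D f t x.
Proof.
move=> bc; apply: contrapT => nolim.
have step d : 0 < d -> exists r r', [/\ D r, D r', t < val r,
    val r < val r' < t + d & f r != f r'].
  move=> d0; have [[x fx]|//] := constant_or_change D f t (t + d).
  by case: nolim; exists x, d.
have many k d : 0 < d -> exists u, [/\ increasing u,
    forall s, s \in u -> D s /\ t < val s < t + d & (k <= changes (map f u))%N].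
  elim: k d => [|k IH] d d0; first by exists [::].
  have [r [r' [Dr Dr' tr /andP[rr' r'd] ne]]] := step d d0.
  have [|u [iu Du ku]] := IH (val r - t); first by rewrite subr_gt0.
  exists (u ++ [:: r; r']); split.
  - apply: increasing_cat => //=; first by rewrite /increasing /= rr'.
    move=> s q /Du[_ /andP[_]]; rewrite subrKC => sr.
    by rewrite !inE => /orP[]/eqP-> //; exact: lt_trans rr'.
  - move=> s; rewrite mem_cat => /orP[/Du[Ds /andP[ts]]|].
      rewrite subrKC => sr; split=> //; rewrite ts/=.
      by rewrite (lt_trans sr)// (lt_trans rr').
    rewrite !inE => /orP[]/eqP->; split=> //; rewrite ?tr ?r'd ?andbT//=.
      exact: lt_trans r'd.
    exact: lt_trans rr'.
  - rewrite map_cat (leq_trans _ (changes_cat_ge _ _))//= changes_from_cons ne.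
    by rewrite addnA addn1 ltnS (leq_trans ku) ?leq_addr.
have [K bK] := bc t (t + 1).
have [u [iu Du]] := many K.+1 1 ltr01.
rewrite leqNgt ltnS bK// => s /Du[Ds /andP[ts st]].
by split=> //=; rewrite !ltW.
Qed.

Lemma left_limit_ex D f t :
  locally_bounded_changes D f -> exists x, left_limit D f t x.
Proof.
move=> bc; apply: contrapT => nolim.
have step d : 0 < d -> exists r r', [/\ D r, D r', t - d < val r,
    val r < val r' < t & f r != f r'].
  move=> d0; have [[x fx]|//] := constant_or_change D f (t - d) t.
  by case: nolim; exists x, d.
have many k d : 0 < d -> exists u, [/\ increasing u,
    forall s, s \in u -> D s /\ t - d < val s < t & (k <= changes (map f u))%N].
  elim: k d => [|k IH] d d0; first by exists [::].
  have [r [r' [Dr Dr' tr /andP[rr' r't] ne]]] := step d d0.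
  have [|u [iu Du ku]] := IH (t - val r'); first by rewrite subr_gt0.
  rewrite subKr in Du.
  exists ([:: r; r'] ++ u); split.
  - apply: increasing_cat => //=; first by rewrite /increasing /= rr'.
    move=> s q + /Du[_ /andP[sr _]].
    by rewrite !inE => /orP[]/eqP-> //; exact: lt_trans sr.
  - move=> s; rewrite mem_cat => /orP[|/Du[Ds /andP[ts ->]]]; last first.
      by split=> //; rewrite andbT (lt_trans _ ts)// (lt_trans tr).
    rewrite !inE => /orP[]/eqP->; split=> //; rewrite ?tr ?r't ?andbT//=.
      exact: lt_trans r't.
    exact: lt_trans rr'.
  - rewrite map_cat (leq_trans _ (changes_cat_ge _ _))//= changes_from_cons ne.
    by rewrite -addnA add1n ltnS (leq_trans ku) ?leq_addl.
have [K bK] := bc (t - 1) t.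
have [u [iu Du]] := many K.+1 1 ltr01.
rewrite leqNgt ltnS bK// => s /Du[Ds /andP[ts st]].
by split=> //=; rewrite !ltW.
Qed.

(** * Extending a function on a set of times to a path *)

(** Where times of [D] accumulate from the right, the limit from the right;
    elsewhere the last value taken before or at [s], that is, the value that is
    constant on [D] from some time of [D] up to [s]. When one-sided limits
    exist, the default state of [xget] is only used before all times of [D]. *)
Definition extension D f (s : R) : X :=
  if `[< rlims (val @` D) s >] then xget point (right_limit D f s)
  else xget point [set x | exists t, [/\ D t, val t <= s &
    forall r, D r -> val t <= val r <= s -> f r = x]].

Lemma extension_rlims D f s x : rlims (val @` D) s ->
  right_limit D f s x -> extension D f s = x.
Proof.
move=> sD fx; rewrite /extension; case: asboolP => // _.
by case: xgetP => [y _ fy|/(_ x)//]; exact: right_limit_uniq fy fx.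
Qed.

Lemma extension_held D f s t x : ~ rlims (val @` D) s -> D t -> val t <= s ->
  (forall r, D r -> val t <= val r <= s -> f r = x) -> extension D f s = x.
Proof.
move=> sD Dt ts fx; rewrite /extension; case: asboolP => // _.
case: xgetP => [y _ [t' [Dt' ts' fy]]|/(_ x)]; last by case; exists t.
case: (leP (val t) (val t')) => tt'.
  by rewrite -(fx t') ?tt'// (fy t') ?lexx.
by rewrite -(fy t) ?(ltW tt')// (fx t) ?lexx.
Qed.

Lemma extension_id D f (t : T) : D t ->
  (rlims (val @` D) (val t) -> right_limit D f (val t) (f t)) ->
  extension D f (val t) = f t.
Proof.
move=> Dt fr; have [tD|tD] := pselect (rlims (val @` D) (val t)).
  by apply: extension_rlims => //; exact: fr.
apply: (extension_held tD Dt) => // r Dr; rewrite -eq_le => /eqP.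
by move/val_inj->.
Qed.

(** If times of [D] accumulate at [t] from the right, then close to [t] both
    clauses of the definition only see the limit from the right; otherwise there
    is an interval to the right of [t] without times of [D], on which the value
    at [t] is held. *)
Lemma extension_right D f t x : right_limit D f t x ->
  exists2 d, 0 < d & forall s, t < s < t + d ->
    extension D f s = extension D f t.
Proof.
have [tD fx|/[dup] tD /rlimsPn[d d0 dD] _] := pselect (rlims (val @` D) t).
  rewrite (extension_rlims tD fx); have [d d0 dx] := fx; exists d => // s.
  move=> /andP[ts sd]; have [sD|sD] := pselect (rlims (val @` D) s).
    apply: extension_rlims => //; exists (t + d - s); first by rewrite subr_gt0.
    move=> r Dr /andP[sr]; rewrite subrKC => rd.
    by apply: dx => //; rewrite rd (lt_trans ts).
  have st0 : 0 < s - t by rewrite subr_gt0.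
  have [r Dr] := rlims_ex tD st0; rewrite subrKC => /andP[tr rs].
  apply: (extension_held sD Dr); first exact: ltW.
  move=> q Dq /andP[rq qs]; apply: dx => //.
  by rewrite (lt_le_trans tr rq) (le_lt_trans qs).
exists d => // s /andP[ts sd].
have DE r : D r -> (val r <= s) = (val r <= t).
  move=> /dD; rewrite negb_and -!leNgt => /orP[rt|dr].
    by rewrite rt (le_trans rt)// ltW.
  rewrite (leNgt _ s) (lt_le_trans sd dr) leNgt; apply/esym/negbTE.
  by rewrite negbK (lt_le_trans _ dr)// ltrDl.
have sD : ~ rlims (val @` D) s.
  move=> sD; have sd0 : 0 < t + d - s by rewrite subr_gt0.
  have [r Dr] := rlims_ex sD sd0; rewrite subrKC => /andP[sr rd].
  by have := dD r Dr; rewrite rd (lt_trans ts).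
rewrite /extension; case: asboolP => // _; case: asboolP => // _.
congr xget; apply/seteqP; split=> y [q [Dq qs fy]]; exists q; split=> //.
- by rewrite -DE.
- by move=> r Dr; rewrite -DE//; exact: fy.
- by rewrite DE.
- by move=> r Dr; rewrite DE//; exact: fy.
Qed.

Lemma extension_left D f t x : left_limit D f t x ->
  exists2 d, 0 < d & exists y, forall s, t - d < s < t -> extension D f s = y.
Proof.
move=> [d d0 dx].
have [[q [Dq /andP[dq qt]]]|none] :=
    pselect (exists q, D q /\ t - d < val q < t).
  exists (t - val q); first by rewrite subr_gt0.
  exists x => s; rewrite subKr => /andP[qs st].
  have [sD|sD] := pselect (rlims (val @` D) s).
    apply: extension_rlims => //; exists (t - s); first by rewrite subr_gt0.
    move=> r Dr /andP[sr]; rewrite subrKC => rt; apply: dx => //.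
    by rewrite rt (lt_trans dq)// (lt_trans qs).
  apply: (extension_held sD Dq); first exact: ltW.
  move=> r Dr /andP[qr rs]; apply: dx => //.
  by rewrite (lt_le_trans dq qr) (le_lt_trans rs).
have dD r : D r -> val r < t -> val r <= t - d.
  move=> Dr rt; rewrite leNgt; apply/negP => dr.
  by apply: none; exists r; rewrite dr.
exists d => //; exists (extension D f (t - d / 2)).
have d2 : t - d < t - d / 2 < t by lra.
suff E s s' : t - d < s < t -> t - d < s' < t -> s <= s' ->
    extension D f s = extension D f s'.
  move=> s sd; case: (leP s (t - d / 2)) => [|/ltW] ss; first exact: E.
  by apply/esym/E.
move=> /andP[ds st] /andP[ds' s't] ss'.
have DE r : D r -> (val r <= s') = (val r <= s).
  move=> Dr; apply/idP/idP => [rs'|/le_trans]; last exact.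
  by rewrite (le_trans (dD r Dr _))// ?(le_lt_trans rs')// ltW.
have nD q : t - d < q < t -> ~ rlims (val @` D) q.
  move=> /andP[dq qt] qD; have qt0 : 0 < t - q by rewrite subr_gt0.
  have [r Dr] := rlims_ex qD qt0; rewrite subrKC => /andP[qr rt].
  by have := dD r Dr rt; rewrite leNgt (lt_trans dq).
have sD : ~ rlims (val @` D) s by apply: nD; rewrite ds.
have s'D : ~ rlims (val @` D) s' by apply: nD; rewrite ds'.
rewrite /extension; case: asboolP => // _; case: asboolP => // _.
congr xget; apply/seteqP; split=> y [q [Dq qs fy]]; exists q; split=> //.
- by rewrite DE.
- by move=> r Dr; rewrite DE//; exact: fy.
- by rewrite -DE.
- by move=> r Dr; rewrite -DE//; exact: fy.
Qed.

Lemma extension_cadlag D f : locally_bounded_changes D f ->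
  (fun t : T => extension D f (val t)) \in @cadlag R X T.
Proof.
move=> bc; apply/mem_set; split.
- move=> t _; have [x fx] := left_limit_ex t bc.
  by have [d d0 [y dy]] := extension_left fx; exists y, d => // s; exact: dy.
- move=> t _; have [x fx] := right_limit_ex t bc.
  have [d d0 dE] := extension_right fx.
  by exists (extension D f t), d => // r; exact: dE.
- move=> t _; have [x fx] := right_limit_ex (val t) bc.
  by have [d d0 dE] := extension_right fx; exists d => // r; exact: dE.
Qed.

(** The tool by which all paths are constructed: from a function on finitely
    many times ([observe_surj]) and from a limit of paths along countably many
    times ([path_cluster]). *)
Lemma path_extending D f : locally_bounded_changes D f ->
  (forall t : T, D t -> rlims (val @` D) (val t) ->
    right_limit D f (val t) (f t)) ->
  exists w : paths X T, forall t : T, D t -> val w t = f t.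
Proof.
move=> bc fr; pose cadlag_fun (w : T -> X) := w \in @cadlag R X T.
exists (exist cadlag_fun _ (extension_cadlag bc)) => t Dt /=.
by apply: extension_id => //; exact: fr.
Qed.

(** * Paths have finitely many jumps in bounded time *)

Lemma bounded_changesS f I J :
  I `<=` J -> bounded_changes f J -> bounded_changes f I.
Proof.
by move=> IJ [K bK]; exists K => u iu uI; apply: bK => // t /uI/IJ.
Qed.

(** For an initial segment [p] of the time axis an increasing sequence splits
    into a part in [p] followed by a part outside [p]. *)
Lemma bounded_changes_split (p : pred T) f I :
  (forall s r : T, val s < val r -> p r -> p s) ->
  bounded_changes f (I `&` [set s | p s]) ->
  bounded_changes f (I `&` [set s | ~~ p s]) -> bounded_changes f I.
Proof.
move=> pdown [K bK] [L bL]; exists (K + L).+1 => u iu uI.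
rewrite (increasing_split pdown iu) map_cat (leq_trans (changes_cat_le _ _))//.
by rewrite ltnS leq_add//; [apply: bK|apply: bL];
  rewrite ?increasing_filter// => s; rewrite mem_filter => /andP[ps /uI].
Qed.

Lemma bounded_changes_cst f I x :
  (forall t, I t -> f t = x) -> bounded_changes f I.
Proof.
move=> fx; exists 0%N => u _ uI.
have /all_pred1P-> : all (pred1 x) (map f u); last by rewrite changes_nseq.
by apply/allP => _ /mapP[t /uI It ->]; rewrite /= fx.
Qed.

(** The one-sided limits at [t] make the path constant on both sides of [t],
    which together with [t] itself are three consecutive pieces. *)
Lemma cadlag_near_bounded_changes (w : T -> X) t : w \in @cadlag R X T ->
  exists2 d, 0 < d & bounded_changes w [set s | t - d < val s < t + d].
Proof.
move=> /set_mem[wl wr _].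
have [dl dl0 [x lx]] : exists2 d, 0 < d &
    exists x, forall s : T, t - d < val s < t -> w s = x.
  have [/wl[x [d d0 dx]]|] := pselect (llims T t).
    by exists d => //; exists x.
  move=> /existsNP[d] /not_implyP[d0 no]; exists d => //; exists point => s sd.
  case: no; exists (val s); split; first by rewrite /= in_itv.
  exact/set_mem/(valP s).
have [dr dr0 [y ry]] : exists2 d, 0 < d &
    exists x, forall s : T, t < val s < t + d -> w s = x.
  have [/wr[y [d d0 dy]]|] := pselect (rlims T t).
    by exists d => //; exists y.
  move=> /existsNP[d] /not_implyP[d0 no]; exists d => //; exists point => s sd.
  case: no; exists (val s); split; first by rewrite /= in_itv.
  exact/set_mem/(valP s).
exists (Num.min dl dr); first by rewrite lt_min dl0.
apply: (@bounded_changes_split (fun s => val s <= t)) => [s r /ltW||].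
- exact: le_trans.
- apply: (@bounded_changes_split (fun s => val s < t)) => [s r||].
  + exact: lt_trans.
  + apply: (@bounded_changes_cst _ _ x) => s [[/andP[+ _] _] /= st].
    rewrite ltrBlDr -ltrBlDl lt_min => /andP[+ _].
    by rewrite ltrBlDl -ltrBlDr => ds; apply: lx; rewrite ds.
  + have [[s0 s0t]|not] := pselect (exists s0 : T, val s0 = t).
      apply: (@bounded_changes_cst _ _ (w s0)) => s [[_ /= st]].
      rewrite -leNgt => ts; congr w; apply: val_inj.
      by apply/eqP; rewrite s0t eq_le st.
    apply: (@bounded_changes_cst _ _ point) => s [[_ /= st]].
    rewrite -leNgt => ts; case: not; exists s.
    by apply/eqP; rewrite eq_le st.
- apply: (@bounded_changes_cst _ _ y) => s [/andP[_]].
  rewrite -ltrBlDl lt_min !ltrBlDl => /andP[_ sd] /=.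
  by rewrite -ltNge => ts; apply: ry; rewrite ts.
Qed.

(** Compactness of [[a, b]], in the form of the supremum of the points up to
    which the number of changes is bounded. *)
Lemma cadlag_locally_bounded_changes (w : T -> X) :
  w \in @cadlag R X T -> locally_bounded_changes setT w.
Proof.
move=> wc a b; rewrite setTI.
have [ba|ab] := ltP b a.
  apply: (@bounded_changes_cst _ _ point) => s /= /andP[/le_trans h /h].
  by rewrite leNgt ba.
pose good c := bounded_changes w [set s : T | a <= val s <= c].
pose E := [set c | a <= c <= b /\ good c].
have Ea : E a.
  split; first by rewrite lexx.
  have [d d0 bd] := cadlag_near_bounded_changes a wc.
  by apply: bounded_changesS bd => s /=; lra.
have Eb : ubound E b by move=> c [/andP[]].
have supE : has_sup E by split; [exists a|exists b].
have [d d0 bd] := cadlag_near_bounded_changes (sup E) wc.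
have [c [cab gc] dc] : exists2 c, E c & sup E - d < c.
  by apply: sup_adherent.
have asup : a <= sup E by apply: ub_le_sup => //; exists b.
have supb : sup E <= b by apply: ge_sup => //; exists a.
have csup : c <= sup E by apply: ub_le_sup => //; exists b.
have gl e : e < sup E + d -> good e.
  move=> ed; apply: (@bounded_changes_split (fun s => val s <= c)).
  - by move=> s r /ltW; exact: le_trans.
  - by apply: bounded_changesS gc => s /= [/andP[-> _] ->].
  - by apply: bounded_changesS bd => s /=; rewrite -ltNge; lra.
have [bs|sb] := leP b (sup E + d / 2); first by apply: gl; lra.
have : E (sup E + d / 2) by split; [lra|apply: gl; lra].
by move/(ub_le_sup (ex_intro _ b Eb)); lra.
Qed.

End Germs.

(** * The algebra of cylinder events *)

Section Grids.
Context {R : realType} {X : pointedType} {T : set R} {S : set T}.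
Implicit Types (u v : grid S) (C : set (paths X T)) (s : seq T).

Lemma grid_increasing u : increasing (val u).
Proof. by have [] := set_mem (valP u). Qed.

Lemma grid_sub u (t : T) : t \in val u -> S t.
Proof. by have [_ _] := set_mem (valP u); exact. Qed.

Lemma grid_neq0 u : val u != [::].
Proof. by have [] := set_mem (valP u). Qed.

Lemma increasing_arrangement s : exists2 v : seq T, increasing v & v =i s.
Proof.
exists (sort (fun a b => val a <= val b) (undup s)).
  rewrite /increasing lt_sorted_uniq_le (map_inj_uniq val_inj) sort_uniq.
  rewrite undup_uniq /= sorted_map; apply: sort_sorted => a b.
  exact: le_total.
by move=> t; rewrite mem_sort mem_undup.
Qed.

Lemma grid_of_seq s : s != [::] -> (forall t : T, t \in s -> S t) ->
  exists u, val u =i s.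
Proof.
move=> s0 sS; have [v iv vs] := increasing_arrangement s.
suff gv : v \in grid S by exists (exist _ v gv).
apply/mem_set; split=> // [|t]; last by rewrite vs; exact: sS.
by apply: contra_neq s0 => v0; apply/nilP; rewrite /nilp -all_pred0;
  apply/allP => t; rewrite -vs v0.
Qed.

Lemma grid_join u v : exists w : grid S,
  {subset val u <= val w} /\ {subset val v <= val w}.
Proof.
have [||w wE] := @grid_of_seq (val u ++ val v).
- by have := grid_neq0 u; case: (val u).
- by move=> t; rewrite mem_cat => /orP[]; exact: grid_sub.
by exists w; split=> t tu; rewrite wE mem_cat tu ?orbT.
Qed.

Lemma not_rlims_seq s (t : R) : ~ rlims (val @` [set r | r \in s]) t.
Proof.
suff [d d0 sd] : exists2 d, 0 < d & forall r, r \in s -> ~~ (t < val r < t + d).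
  move=> ts; have [r rs tr] := rlims_ex ts d0.
  by move: tr; apply/negP/sd.
elim: s => [|a s [d d0 IH]]; first by exists 1.
have [at_|ta] := leP (val a) t.
  exists d => // r; rewrite inE => /orP[/eqP->|/IH//].
  by rewrite ltNge at_.
exists (Num.min d (val a - t)); first by rewrite lt_min d0 subr_gt0.
move=> r; rewrite inE; apply: contraL => /andP[tr].
rewrite -ltrBlDl lt_min ltrBlDl ltrD2r => /andP[rd ra].
rewrite negb_or; apply/andP; split.
  by apply: contraTneq ra => ->; rewrite ltxx.
by apply/negP => /IH; rewrite tr rd.
Qed.

Lemma observeP u (w w' : paths X T) :
  observe u w = observe u w' <->
  (forall t : T, t \in val u -> val w t = val w' t).
Proof.
split=> [/funeqP e t tu|e]; first exact: (e (SeqSub tu)).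
by apply/funext => t; exact/e/valP.
Qed.

(** Finitely many times have no limit points, so that any function on them
    extends to a path. *)
Lemma observe_surj u (x : states X (val u)) : exists w, observe u w = x.
Proof.
pose f (t : T) := if insub t is Some s then x s else point.
have [||w wE] := @path_extending _ _ _ [set t | t \in val u] f.
- move=> a b; exists (size (val u)) => v iv vu.
  rewrite (leq_trans (changes_size _))// size_map.
  by rewrite uniq_leq_size ?increasing_uniq// => t /vu[].
- by move=> t _ /not_rlims_seq.
exists w; apply/funext => t; rewrite /observe wE; last exact: valP.
by rewrite /f valK.
Qed.

(** The cylinder events are the sets of paths that depend on finitely many
    times. This form makes the boolean operations on them immediate, whatever
    the grids they come from. *)
Definition depends_on s C : Prop := forall w w' : paths X T,
  (forall t : T, t \in s -> val w t = val w' t) -> C w -> C w'.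

Lemma depends_onS s1 s2 C : {subset s1 <= s2} ->
  depends_on s1 C -> depends_on s2 C.
Proof. by move=> s12 dC w w' e; apply: dC => t /s12; exact: e. Qed.

Lemma depends_on_cylinder u (A : set (states X (val u))) :
  depends_on (val u) (cylinder A).
Proof. by move=> w w' /observeP; rewrite /cylinder/= => ->. Qed.

Lemma cylindersP C : cylinders X S C <-> exists u, depends_on (val u) C.
Proof.
split=> [[u [A ->]]|[u dC]]; first by exists u; exact: depends_on_cylinder.
exists u, (observe u @` C); apply/seteqP; split=> w; first by exists w.
by move=> [w' Cw' /observeP e]; exact: dC Cw'.
Qed.

Lemma cylinders0 : S !=set0 -> cylinders X S set0.
Proof.
move=> [t St]; apply/cylindersP.
have [//||u _] := @grid_of_seq [:: t]; last by exists u => w w' _ [].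
by move=> r; rewrite inE => /eqP->.
Qed.

(** Unlike [cylindersP], this allows the empty sequence of times. *)
Lemma cylinders_seq s C : S !=set0 ->
  (forall t : T, t \in s -> S t) -> depends_on s C -> cylinders X S C.
Proof.
move=> S0 sS dC; apply/cylindersP; have [s0|s0] := eqVneq s [::].
  have /cylindersP[u _] := cylinders0 S0.
  by exists u; apply: depends_onS dC => t; rewrite s0.
have [u us] := grid_of_seq s0 sS.
by exists u; apply: depends_onS dC => t; rewrite us.
Qed.

Lemma cylindersC C : cylinders X S C -> cylinders X S (~` C).
Proof.
move=> /cylindersP[u dC]; apply/cylindersP; exists u => w w' e nC Cw'.
by apply: nC; apply: dC Cw' => t tu; rewrite e.
Qed.

Lemma countable_times (u_ : nat -> grid S) :
  exists d : nat -> T, forall t : T,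
    (exists i, t \in val (u_ i)) <-> exists j, d j = t.
Proof.
have [t0 t0u] : exists t0, t0 \in val (u_ 0%N).
  have := grid_neq0 (u_ 0%N); case: (val _) => // t0 s.
  by exists t0; exact: mem_head.
exists (fun n =>
  if unpickle n is Some (i, j) then nth t0 (val (u_ i)) j else t0).
move=> t; split=> [[i ti]|[n <-]].
  by exists (pickle (i, index t (val (u_ i)))); rewrite pickleK nth_index.
case: (unpickle n) => [[i j]|]; last by exists 0%N.
have [ji|ij] := ltnP j (size (val (u_ i))); first by exists i; exact: mem_nth.
by exists 0%N; rewrite nth_default.
Qed.

Lemma depends_onU s C1 C2 :
  depends_on s C1 -> depends_on s C2 -> depends_on s (C1 `|` C2).
Proof.
by move=> d1 d2 w w' e [Cw|Cw]; [left; exact: d1 Cw|right; exact: d2 Cw].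
Qed.

Lemma cylinders_common C1 C2 : cylinders X S C1 -> cylinders X S C2 ->
  exists u, depends_on (val u) C1 /\ depends_on (val u) C2.
Proof.
move=> /cylindersP[u d1] /cylindersP[v d2]; have [w [uw vw]] := grid_join u v.
by exists w; split; [exact: depends_onS d1|exact: depends_onS d2].
Qed.

Lemma cylindersU C1 C2 :
  cylinders X S C1 -> cylinders X S C2 -> cylinders X S (C1 `|` C2).
Proof.
move=> c1 c2; have [u [d1 d2]] := cylinders_common c1 c2.
by apply/cylindersP; exists u; exact: depends_onU.
Qed.

Lemma cylindersI C1 C2 :
  cylinders X S C1 -> cylinders X S C2 -> cylinders X S (C1 `&` C2).
Proof.
move=> c1 c2; rewrite -[C1]setCK -[C2]setCK -setCU.
by apply: cylindersC; apply: cylindersU; exact: cylindersC.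
Qed.

(** * The content defined by consistent finite-dimensional distributions *)

Context (mu : fdds X S).

(** [0] is a junk value for the sets of paths that are not cylinder events. *)
Definition premeasure C : \bar R :=
  if pselect (exists u, depends_on (val u) C) is left e
  then mu (projT1 (cid e)) (observe _ @` C) else 0.

(** Independence of the grid: two grids are compared through their union, by
    consistency, and [observe_surj] ensures that the event seen on the finer
    grid is the full preimage of the event seen on the coarser one. *)
Lemma premeasureE u C : consistent mu -> depends_on (val u) C ->
  premeasure C = mu u (observe u @` C).
Proof.
move=> muc; have joinE v w : {subset val v <= val w} -> depends_on (val v) C ->
    mu v (observe v @` C) = mu w (observe w @` C).
  move=> vw dC; rewrite (muc v w vw); congr (mu w _).
  apply/seteqP; split=> [x|_ [p Cp <-]]; last by exists p.
  have [p <-] := observe_surj x; move=> [q Cq /observeP qp]; exists p => //.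
  by apply: dC Cq => t tv; exact: (qp t tv).
move=> dC; rewrite /premeasure; case: pselect => [e|]; last by case; exists u.
have dC' := projT2 (cid e); set v := projT1 (cid e) in dC' *.
by have [w [uw vw]] := grid_join u v; rewrite (joinE u w)// (joinE v w).
Qed.

Lemma premeasure_cylinder u (A : set (states X (val u))) :
  consistent mu -> premeasure (cylinder A) = mu u A.
Proof.
move=> muc; rewrite (premeasureE muc (depends_on_cylinder (A := A))).
congr (mu u _); apply/seteqP; split=> [_ [w Aw <-]//|x].
by have [w <-] := observe_surj x; exists w.
Qed.

Lemma premeasure_ge0 C : (0 <= premeasure C)%E.
Proof. by rewrite /premeasure; case: pselect. Qed.

Lemma premeasure0 : S !=set0 -> consistent mu -> premeasure set0 = 0.
Proof.
move=> S0 muc; have /cylindersP[u d0] := cylinders0 S0.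
by rewrite (premeasureE muc d0) image_set0 measure0.
Qed.

Lemma premeasureU C1 C2 : consistent mu ->
  cylinders X S C1 -> cylinders X S C2 -> C1 `&` C2 = set0 ->
  premeasure (C1 `|` C2) = (premeasure C1 + premeasure C2)%E.
Proof.
move=> muc c1 c2 C12; have [u [d1 d2]] := cylinders_common c1 c2.
rewrite (premeasureE muc d1) (premeasureE muc d2).
rewrite (premeasureE muc (depends_onU d1 d2)) image_setU measureU//.
rewrite -subset0 => _ [[w Cw <-] [w' Cw' /observeP e]].
suff : (C1 `&` C2) w by rewrite C12.
by split=> //; exact: d2 Cw'.
Qed.

End Grids.

(** A copy of the type of paths that carries the algebra of cylinder events. It
    is indexed by [S0] because grids are not empty: without times in [S] there
    would be no grid and thus no cylinder event. *)
Definition cylinder_space {R : realType} (X : pointedType) {T : set R}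
    {S : set T} (S0 : S !=set0) : Type := paths X T.

Section CylinderContent.
Context {R : realType} {X : pointedType} {T : set R} {S : set T}.
Context (S0 : S !=set0).

HB.instance Definition _ := Pointed.copy (cylinder_space X S0) (paths X T).

HB.instance Definition _ := @isAlgebraOfSets.Build default_measure_display
  (cylinder_space X S0) (cylinders X S) (cylinders0 S0) cylindersU cylindersC.

Definition cylinder_content (mu : fdds X S) (muc : consistent mu) :
  set (cylinder_space X S0) -> \bar R := premeasure mu.

Context (mu : fdds X S) (muc : consistent mu).

Lemma cylinder_content_semi_additive :
  measure_function.semi_additive (cylinder_content muc).
Proof.
apply/additive2P; first exact: premeasure0.
by move=> C1 C2 c1 c2 C12; exact: premeasureU.
Qed.

HB.instance Definition _ := isContent.Build _ _ _ (cylinder_content muc)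
  (@premeasure_ge0 _ _ _ _ mu) cylinder_content_semi_additive.

End CylinderContent.

(** * Auxiliary facts on measures and filters *)

Lemma exists_avoiding d (R : realType) (U : ringOfSetsType d)
    (m : {content set U -> \bar R}) (C : set U) (B : (set U)^nat) (n : nat) :
  measurable C -> (forall l, measurable (B l)) ->
  (\sum_(l < n) m (B l) < m C)%E ->
  exists2 w, C w & forall l, (l < n)%N -> ~ B l w.
Proof.
move=> mC mB; apply: contraPP => avoid; apply/negP; rewrite -leNgt.
apply: content_subadditive => // w Cw.
apply: contrapT => nBw; apply: avoid; exists w => // l ln Blw.
by apply: nBw; rewrite -bigcup_mkord; exists l.
Qed.

(** [P (A n)] is at most the probability of the union of the [A k] with
    [k >= n], which decreases to the empty limit superior of [A]. *)
Lemma probability_lim_sup_empty d (R : realType) (U : measurableType d)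
    (P : probability U R) (A : (set U)^nat) (e : R) :
  (forall n, measurable (A n)) ->
  (forall w, exists N, forall n, (N <= n)%N -> ~ A n w) ->
  0 < e -> \forall n \near \oo, (P (A n) < e%:E)%E.
Proof.
move=> mA Aempty e0.
have limA : lim_sup_set A = set0.
  rewrite -subset0 => w Aw; have [N AN] := Aempty w.
  by have [n /= Nn Anw] := Aw N I; exact: AN Anw.
have /(lim_sup_set_cvg P A mA) : (P (\bigcup_(k >= 0) A k) < +oo)%E.
  rewrite (le_lt_trans (probability_le1 _ _)) ?ltry//.
  exact: bigcup_measurable.
rewrite limA measure0 => /fine_cvgP[fin /cvgrPdist_lt /(_ e e0)].
move=> near_e; near=> n.
have tail_fin : P (\bigcup_(k >= n) A k) \is a fin_num by near: n.
rewrite (@le_lt_trans _ _ (P (\bigcup_(k >= n) A k)))//.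
  apply: le_measure; rewrite ?inE//; first exact: bigcup_measurable.
  by move=> w Anw; exists n => //=.
rewrite -(fineK tail_fin) lte_fin; apply: le_lt_trans (ler_norm _) _.
by rewrite -normrN -sub0r; near: n.
Unshelve. all: by end_near. Qed.

(** A finite partition has exactly one piece in the ultrafilter; this is where
    tightness enters the construction of limits. *)
Lemma ultra_bounded_value I (F : set_system I) (g : I -> nat) (n : nat) :
  UltraFilter F -> F [set i | (g i < n)%N] -> exists k, F [set i | g i = k].
Proof.
move=> FU; elim: n => [|n IH] Fn; first by have [i] := filter_ex Fn.
have [|Fne] := in_ultra_setVsetC [set i | g i = n] FU; first by exists n.
apply: IH; apply: filterS2 Fn Fne => i /=.
by rewrite ltnS leq_eqVlt => /orP[/eqP|].
Qed.

Lemma filter_all_seq (I : Type) (F : set_system I) (E : eqType) (s : seq E)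
    (Q : I -> E -> Prop) :
  Filter F -> (forall t, t \in s -> F [set i | Q i t]) ->
  F [set i | forall t, t \in s -> Q i t].
Proof.
move=> FF; elim: s => [|a s IH] FQ; first exact: filterE.
have Fs : F [set i | forall t, t \in s -> Q i t].
  by apply: IH => t ts; apply: FQ; rewrite inE ts orbT.
have Fa : F [set i | Q i a] by apply: FQ; rewrite mem_head.
apply: filterS2 Fa Fs => i Qa Qs t.
by rewrite inE => /orP[/eqP->//|]; exact: Qs.
Qed.

Lemma sum_geometric (R : realType) (e : R) n :
  \sum_(l < n) e / 2 ^+ l.+1 = e - e / 2 ^+ n.
Proof.
elim: n => [|n IH]; first by rewrite big_ord0 expr0 divr1 subrr.
rewrite big_ord_recr/= IH exprS invfM mulrCA [2^-1 * _]mulrC.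
by set a := e / _; lra.
Qed.

(** * Limits of sequences of paths along an ultrafilter *)

Section Compactness.
Context {R : realType} {X : pointedType} {T : set R}.

(** The three hypotheses on the sequence of paths are pointwise tightness,
    right-continuity in the limit and a uniform bound on the jumps. Because the
    bound on the jumps already provides limits from the right, right-continuity
    needs to be checked along one sequence of times [r] tending to [t] only. *)
Lemma path_cluster (D : set T) (w_ : nat -> paths X T) (f : X -> nat) :
  injective f ->
  (forall t : T, D t ->
    exists k : nat, \forall n \near \oo, (f (val (w_ n) t) < k)%N) ->
  (forall t : T, D t -> rlims (val @` D) (val t) -> forall e, 0 < e ->
    exists r : T, [/\ D r, val t < val r < val t + e &
      \forall n \near \oo, val (w_ n) t = val (w_ n) r]) ->
  (forall l : nat, exists K, forall u : seq T, increasing u ->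
    (forall t : T, t \in u -> D t /\ - (l%:R : R) <= val t <= l%:R) ->
    \forall n \near \oo, (changes (map (val (w_ n)) u) <= K)%N) ->
  exists w : paths X T, exists2 F : set_system nat,
    ProperFilter F /\ (\oo `<=` F) &
    forall t : T, D t -> F [set n | val (w_ n) t = val w t].
Proof.
move=> finj tight rc bc.
have [F [FU ooF]] := ultraFilterLemma eventually_filter.
pose g (t : T) := xget point [set x | F [set n | val (w_ n) t = x]].
have gF t : D t -> F [set n | val (w_ n) t = g t].
  move=> Dt; have [k /ooF/ultra_bounded_value[i Fi]] := tight t Dt.
  have [n0 n0i] := filter_ex Fi.
  rewrite /g; case: xgetP => // /(_ (val (w_ n0) t)); case.
  by apply: filterS Fi => n /= ni; apply: finj; rewrite ni n0i.
have gbc : locally_bounded_changes D g.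
  move=> a b; pose l := (Num.truncn (`|a| + `|b|)).+1.
  have abl : `|a| + `|b| < l%:R by exact: truncnS_gt.
  have [la bl] : - l%:R <= a /\ b <= l%:R.
    have := ler_norm b; have := ler_norm (- a); have := normr_ge0 a.
    by have := normr_ge0 b; rewrite normrN; lra.
  have [K bK] := bc l; exists K => u iu uD.
  have /ooF uK : \forall n \near \oo, (changes (map (val (w_ n)) u) <= K)%N.
    apply: bK => // t /uD[Dt /andP[at_ tb]]; split=> //.
    by rewrite (le_trans la at_) (le_trans tb bl).
  have ug : F [set n | forall t, t \in u -> val (w_ n) t = g t].
    by apply: filter_all_seq => t /uD[Dt _]; exact: gF.
  have [n [nK nE]] := filter_ex (filterI uK ug).
  by rewrite -((eq_in_map _ _ _).1 nE).
have gr (t : T) : D t -> rlims (val @` D) (val t) ->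
    right_limit D g (val t) (g t).
  move=> Dt tD; have [x [d d0 dx]] := right_limit_ex (val t) gbc.
  (* A single time [r] at which the limit is attained suffices. *)
  have [r [Dr tr /ooF Ftr]] := rc t Dt tD d d0.
  suff -> : g t = x by exists d.
  have [n [[nt nr] ntr]] :=
    filter_ex (filterI (filterI (gF t Dt) (gF r Dr)) Ftr).
  by rewrite -(dx r)// -nt -nr.
have [w wE] := path_extending gbc gr.
exists w, F => [|t Dt]; first by split => //; exact: ultra_proper.
by apply: filterS (gF t Dt) => n /= ->; exact/esym/wE.
Qed.

End Compactness.

(** * Regularity makes the content countably additive *)

Section SigmaAdditivity.
Context {R : realType} {X : pointedType} {T : set R} {S : set T}.
Context (S0 : S !=set0) (mu : fdds X S) (muc : consistent mu).
Context (mur : regular mu).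
Implicit Types (u v : grid S) (t r : T) (e : R).

Local Notation m := (@cylinder_content R X T S S0 mu muc).

Lemma content_tight (f : X -> nat) t e : S t -> 0 < e ->
  exists n : nat, (m [set w | n <= f (val w t)]%N <= e%:E)%E.
Proof.
move=> St e0; have [||u uE] := @grid_of_seq R T S [:: t].
- by [].
- by move=> r; rewrite inE => /eqP->.
have tu : t \in val u by rewrite uE mem_head.
pose A n : set (states X (val u)) := [set x | n <= f (x (SeqSub tu))]%N.
have /(_ e e0)[N _ NA] : forall e, 0 < e ->
    \forall n \near \oo, (mu u (A n) < e%:E)%E.
  move=> e'; apply: probability_lim_sup_empty => // x.
  exists (f (x (SeqSub tu))).+1 => n ln; rewrite /A/=; apply/negP.
  by rewrite -ltnNge.
exists N; rewrite (_ : [set w | _] = cylinder (A N))//.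
by rewrite [m _]premeasure_cylinder// ltW// NA/=.
Qed.

Lemma content_right_continuous t e : S t -> rlims (val @` S) (val t) ->
  0 < e -> exists2 d, 0 < d & forall r, S r -> val t < val r < val t + d ->
    (m [set w | val w t <> val w r] <= e%:E)%E.
Proof.
move=> St tS e0; have [rc _] := mur; have := rc t St tS.
have FF := later_nbhs_filter S t.
move=> /fine_cvgP[_ /cvgrPdist_lt /(_ e e0)[d /= d0 near_t]].
exists d => // r Sr /andP[tr rd].
have rl : r \in later S t by apply/mem_set.
have := near_t (exist _ r rl) rd.
set u := pair_grid St _ => /=.
have -> : [set w | val w t <> val w r] =
    @cylinder R X T S u (~` agree t r).
  by apply/seteqP; split=> w.
rewrite [m _]premeasure_cylinder// probability_setC//.
rewrite -[mu u _]fineK ?fin_num_measure// -EFinB lee_fin => near_e.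
exact/ltW/(le_lt_trans _ near_e)/ler_norm.
Qed.

(** The window is enlarged to [n.+1] because regularity speaks of positive
    integers only. *)
Lemma content_bounded_changes (n : nat) e : 0 < e ->
  exists K : nat, forall s : seq T, increasing s ->
    (forall t, t \in s -> S t /\ - (n%:R : R) <= val t <= n%:R) ->
    (m [set w | K < changes (map (val w) s)]%N <= e%:E)%E.
Proof.
move=> e0; have [_ bj] := mur.
have nS (a : R) : - n%:R <= a <= n%:R -> - n.+1%:R <= a <= n.+1%:R.
  by rewrite -natr1; lra.
have [wn0|wn0] := pselect (@window R T S n.+1 !=set0); last first.
  exists 0%N => s _ sS; case: s sS => [_|t s /(_ t)].
    rewrite (_ : [set w | _] = set0); last by rewrite -subset0.
    by rewrite [m _]premeasure0 ?lee_fin ?ltW.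
  rewrite mem_head => /(_ isT)[St tn]; case: wn0; exists t; split=> //=.
  exact: nS.
have := bj n.+1 isT wn0.
move=> /fine_cvgP[[N1 _ fin] /cvgrPdist_lt /(_ e e0)[N2 _ near_e]].
exists (maxn N1 N2) => -[_ _|t s]; first rewrite (_ : [set w | _] = set0).
- by rewrite [m _]premeasure0 ?lee_fin ?ltW.
- by rewrite -subset0.
set s' := t :: s => is' sS.
have gs : s' \in grid S by apply/mem_set; split=> // r /sS[].
pose u : grid S := exist _ s' gs.
set K := maxn _ _.
have -> : [set w | K < changes (map (val w) s')]%N =
    @cylinder R X T S u [set x | (K.+1 <= jumps x)%N].
  apply/seteqP; split=> w;
    by rewrite /cylinder/= [jumps _]jumps_changes ?increasing_uniq.
rewrite [m _]premeasure_cylinder//.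
have NK1 : (N1 <= K.+1)%N by rewrite (leq_trans (leq_maxl N1 N2)).
have NK2 : (N2 <= K.+1)%N by rewrite (leq_trans (leq_maxr N1 N2)).
have := near_e K.+1 NK2; have /= := fin K.+1 NK1.
set s_ := ereal_sup _ => s_fin sup_lt.
have : (mu u [set x | (K.+1 <= jumps x)%N] <= s_)%E.
  apply: ereal_sup_ubound; exists u => //=; split=> // r rs.
  split; last by have [] := sS r rs.
  by have [_] := sS r rs; exact: nS.
move/le_trans; apply; rewrite -(fineK s_fin) lee_fin.
by rewrite ltW// (le_lt_trans (ler_norm _))// -normrN -sub0r.
Qed.

Context (Xc : countable [set: X]).

(** Tightness, right-continuity and bounds on the jumps at the times [d j] are
    countably many constraints, each of which fails with as small a measure as
    wanted. The event [B n l] collects the failures at stage [n] of the [l]-th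
    constraint of each of the three types. Only the bound on the jumps depends
    on the stage, as it refers to the first [n] times; regularity bounds the
    measure of its failure uniformly in [n]. *)
Lemma compactness_events (d : nat -> T) e : 0 < e -> (forall j, S (d j)) ->
  exists B : nat -> nat -> set (paths X T), [/\
    forall n l, cylinders X S (B n l),
    forall n l, (m (B n l) <= (e / 2 ^+ l.+1)%:E)%E &
    forall w_ : nat -> paths X T, (forall n l, (l < n)%N -> ~ B n l (w_ n)) ->
      exists w : paths X T, exists2 F : set_system nat,
        ProperFilter F /\ (\oo `<=` F) &
        forall j, F [set n | val (w_ n) (d j) = val w (d j)]].
Proof.
move=> e0 dS; pose D := [set t | exists j, d j = t].
have DS : D `<=` S by move=> _ [j <-].
have /countable_injP[f finj] := Xc.
have {}finj : injective f by move=> x y; apply: finj; rewrite inE.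
pose e_ l := e / 3 / 2 ^+ l.+1.
have e_gt0 l : 0 < e_ l by rewrite !divr_gt0// exprn_gt0.
have /choice[k kP] : forall l, exists k : nat,
    (m [set w | k <= f (val w (d l))]%N <= (e_ l)%:E)%E.
  by move=> l; exact: content_tight.
(* The [l]-th constraint of the second type, for [l] encoding [(j, b)], asks
   for equal values at [d j] and at a time less than [1 / (b + 1)] later. *)
pose p l : nat * nat := odflt (0, 0)%N (unpickle l).
have /choice[q qP] : forall l, exists r, [/\ D r,
    rlims (val @` D) (val (d (p l).1)) ->
      val (d (p l).1) < val r < val (d (p l).1) + (p l).2.+1%:R^-1 &
    (m [set w | val w (d (p l).1) <> val w r] <= (e_ l)%:E)%E].
  move=> l; have [tD|tD] := pselect (rlims (val @` D) (val (d (p l).1))).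
    have tS : rlims (val @` S) (val (d (p l).1)).
      move=> a a0; have [r Dr tr] := rlims_ex tD a0; exists (val r).
      by split; [rewrite /= in_itv|exists r => //; exact: DS].
    have [a a0 aP] := content_right_continuous (dS _) tS (e_gt0 l).
    pose b := Num.min a (p l).2.+1%:R^-1.
    have b0 : 0 < b by rewrite lt_min a0 invr_gt0 ltr0n.
    have [r Dr /andP[tr]] := rlims_ex tD b0.
    rewrite -ltrBlDl lt_min !ltrBlDl => /andP[ra rb].
    exists r; split=> // [_|]; first by rewrite tr rb.
    by apply: aP; [exact: DS|rewrite tr].
  exists (d (p l).1); split=> //; first by exists (p l).1.
  rewrite (_ : [set w | _] = set0); last by rewrite -subset0.
  by rewrite measure0 lee_fin ltW.
have /choice[K KP] : forall l, exists K : nat, forall s : seq T, increasing s ->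
    (forall t, t \in s -> S t /\ - (l%:R : R) <= val t <= l%:R) ->
    (m [set w | K < changes (map (val w) s)]%N <= (e_ l)%:E)%E.
  by move=> l; exact: content_bounded_changes.
(* [g l n] lists those of the first [n] times that lie in [[-l, l]]. *)
have /choice[g gP] : forall l : nat, exists g : nat -> seq T,
    forall n, increasing (g n) /\
      g n =i [seq t <- map d (iota 0 n) | - (l%:R : R) <= val t <= l%:R].
  move=> l.
  pose tl n := [seq t <- map d (iota 0 n) | - (l%:R : R) <= val t <= l%:R].
  suff /choice[g gE] : forall n, exists v : seq T, increasing v /\ v =i tl n.
    by exists g.
  by move=> n; have [v iv vE] := increasing_arrangement (tl n); exists v.
have gS l n t : t \in g l n -> S t /\ - (l%:R : R) <= val t <= l%:R.
  have [_ ->] := gP l n; rewrite mem_filter => /andP[tl /mapP[j _ tE]].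
  by split; rewrite // tE.
pose E1 l : set (paths X T) := [set w | k l <= f (val w (d l))]%N.
pose E2 l : set (paths X T) := [set w | val w (d (p l).1) <> val w (q l)].
pose E3 l n : set (paths X T) :=
  [set w | K l < changes (map (val w) (g l n))]%N.
have mE1 l : cylinders X S (E1 l).
  apply: (@cylinders_seq _ X _ _ [:: d l]) => [//|t|w w' ww'].
    by rewrite inE => /eqP->.
  by rewrite /E1/= ww'// mem_head.
have mE2 l : cylinders X S (E2 l).
  have [Dq _ _] := qP l.
  apply: (@cylinders_seq _ X _ _ [:: d (p l).1; q l]) => [//|t|w w' ww'].
    by rewrite !inE => /orP[]/eqP->//; exact: DS.
  by rewrite /E2/= !ww'// !inE eqxx ?orbT.
have mE3 l n : cylinders X S (E3 l n).
  apply: (@cylinders_seq _ X _ _ (g l n)) => [//|t /gS[]//|w w' ww'].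
  by rewrite /E3/= ((eq_in_map _ _ _).1 ww').
have mE12 l : cylinders X S (E1 l `|` E2 l).
  exact: cylindersU (mE1 l) (mE2 l).
exists (fun n l => E1 l `|` E2 l `|` E3 l n); split=> [n l|n l|w_ wP].
- exact: cylindersU (mE12 l) (mE3 l n).
- have -> : e / 2 ^+ l.+1 = e_ l + e_ l + e_ l.
    by rewrite /e_ -!mulrDl; congr (_ / _); lra.
  rewrite !EFinD (le_trans (measureU2 m (mE12 l) (mE3 l n)))//.
  apply: leeD; last by apply: KP => [|t]; [have [] := gP l n|exact: gS].
  rewrite (le_trans (measureU2 m (mE1 l) (mE2 l)))// leeD// ?kP//.
  by have [] := qP l.
have [|||w [G [GF ooG] wG]] := @path_cluster R X T D w_ f finj.
- move=> t [j <-]; exists (k j); near=> n.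
  rewrite ltnNge; apply/negP => kn.
  have := wP n j; case; first by near: n; exact: nbhs_infty_gt.
  by left; left.
- move=> t [j <-] tD a a0.
  have [b ba] := @ltr_add_invr R 0 a a0; rewrite add0r in ba.
  pose l := pickle (j, b).
  have := qP l; rewrite /p pickleK /= => -[Dq /(_ tD)/andP[tq qb] _].
  exists (q l); split=> //; first by rewrite tq (lt_trans qb)// ltrD2l.
  near=> n; apply: contrapT => ne.
  have := wP n l; case; first by near: n; exact: nbhs_infty_gt.
  by left; right; rewrite /E2 /p pickleK.
- move=> l; exists (K l) => s si sD.
  have sg : \forall n \near \oo, forall t, t \in s -> t \in g l n.
    apply: filter_all_seq => t /sD[[j dj] tl].
    near=> n; have [_ gE] := gP l n; rewrite /= gE mem_filter tl/= -dj map_f//.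
    by rewrite mem_iota; near: n; exact: nbhs_infty_gt.
  near=> n; rewrite leqNgt; apply/negP => Kn.
  have := wP n l; case; first by near: n; exact: nbhs_infty_gt.
  right; apply: (leq_trans Kn); apply: changes_subseq; apply: map_subseq.
  apply: increasing_subseq => //; first by have [] := gP l n.
  by near: n.
by exists w, G => // j; apply: wG; exists j.
Unshelve. all: by end_near. Qed.

(** The gap between the two sides of the inequality pays for the events of
    [compactness_events], so that finite additivity still leaves a path in [C]
    that avoids the first [n] of all these events; on any finite set of relevant
    times the limit of these paths agrees with [w_ n] for some large [n]. *)
Lemma path_avoiding_cover (C : set (cylinder_space X S0))
    (F : (set (cylinder_space X S0))^nat) :
  measurable C -> (forall i, measurable (F i)) ->
  (\sum_(i <oo) m (F i) < m C)%E -> exists2 w, C w & forall i, ~ F i w.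
Proof.
move=> mC mF sum_lt.
have [uC dC] := (cylindersP _).1 mC.
have /choice[uF dF] : forall i, exists u, depends_on (val u) (F i).
  by move=> i; exact/cylindersP/mF.
pose u_ i := if i is j.+1 then uF j else uC.
have [d dE] := countable_times u_.
have dS j : S (d j).
  by have [i] := (dE (d j)).2 (ex_intro _ j erefl); exact: grid_sub.
have [e e0 sum_le] : exists2 e, 0 < e &
    (\sum_(i <oo) m (F i) + e%:E <= m C)%E.
  have mCfin : m C \is a fin_num.
    by rewrite [m C](premeasureE muc dC) fin_num_measure.
  have sfin : (\sum_(i <oo) m (F i))%E \is a fin_num.
    rewrite ge0_fin_numE; last exact: nneseries_ge0.
    by rewrite (lt_trans sum_lt)// ltey_eq mCfin.
  exists (fine (m C) - fine (\sum_(i <oo) m (F i))%E).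
    by rewrite subr_gt0 fine_lt.
  by rewrite EFinB !fineK// [leLHS]addeC subeK.
have [B [mB Ble Blim]] := compactness_events e0 dS.
have mFB n l : cylinders X S (F l `|` B n l).
  exact: cylindersU (mF l) (mB n l).
have /choice[w_ wP] : forall n, exists w,
    C w /\ forall l, (l < n)%N -> ~ (F l `|` B n l) w.
  move=> n.
  have [|w Cw Bw] :=
    @exists_avoiding _ _ _ m C (fun l => F l `|` B n l) n mC (mFB n).
    apply: (@le_lt_trans _ _ (\sum_(l < n) (m (F l) + (e / 2 ^+ l.+1)%:E))%E).
      apply: lee_sum => l _.
      apply: le_trans (measureU2 m (mF l) (mB n l)) _.
      exact: leeD (lexx _) (Ble n l).
    have sum_n : (\sum_(l < n) m (F l) <= \sum_(i <oo) m (F i))%E.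
      by rewrite -(big_mkord xpredT (fun l => m (F l))) nneseries_lim_ge.
    apply: lt_le_trans sum_le; rewrite big_split/= sumEFin sum_geometric.
    apply: lee_ltD.
    - rewrite ge0_fin_numE; last exact: sume_ge0.
      by rewrite (le_lt_trans sum_n)// (lt_le_trans sum_lt)// leey.
    - exact: sum_n.
    - by rewrite lte_fin ltrBlDr ltrDl divr_gt0// exprn_gt0.
  by exists w.
have [|w [G [GF ooG] wG]] := Blim w_.
  by move=> n l ln Bw; have [_ /(_ l ln)] := wP n; apply; right.
have agreeG i :
    G [set n | forall t, t \in val (u_ i) -> val (w_ n) t = val w t].
  apply: filter_all_seq => t tu.
  by have [j <-] := (dE t).1 (ex_intro _ i tu); exact: wG.
exists w.
  have [n wn] := filter_ex (agreeG 0%N).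
  by apply: dC wn _; have [] := wP n.
move=> i Fiw.
have [n [wn ni]] :=
  filter_ex (filterI (agreeG i.+1) (ooG _ (nbhs_infty_gt i))).
have [_ /(_ i ni)] := wP n; apply; left.
by apply: dF Fiw => t tu; rewrite wn.
Qed.

Lemma cylinder_content_sigma_additive : semi_sigma_additive m.
Proof.
apply: content_ring_sigma_additive => C F mF mC CF.
rewrite leNgt; apply/negP => /(path_avoiding_cover mC mF)[w /CF[i _ Fiw]].
by move=> /(_ i).
Qed.

End SigmaAdditivity.

(** * Existence, necessity of regularity and uniqueness *)

Section Extension.
Context {R : realType} {X : pointedType} {T : set R} {S : set T}.
Context (mu : fdds X S).
Implicit Types (u v : grid S) (t r : T) (e : R).

(** [cylinder_content], renamed to carry the hypotheses under which it is
    countably additive. *)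
Definition cylinder_premeasure (S0 : S !=set0) (muc : consistent mu)
    (mur : regular mu) (Xc : countable [set: X]) :
  set (cylinder_space X S0) -> \bar R := @cylinder_content R X T S S0 mu muc.

HB.instance Definition _ S0 muc mur Xc := isMeasure.Build _ _ _
  (@cylinder_premeasure S0 muc mur Xc) (measure0 _) (measure_ge0 _)
  (cylinder_content_sigma_additive mur Xc).

Lemma regular_extends : S !=set0 -> consistent mu -> regular mu ->
  countable [set: X] -> exists P : path_probability X S, extends P mu.
Proof.
move=> S0 muc mur Xc.
pose m := @cylinder_premeasure S0 muc mur Xc.
pose P : set (g_sigma_algebraType (cylinders X S)) -> \bar R :=
  measure_extension m.
have PE u (A : set (states X (val u))) : P (cylinder A) = mu u A.
  rewrite /P /measure_extension measurable_mu_extE//.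
    exact: premeasure_cylinder.
  by exists u, A.
have PT : P setT = 1%E.
  have /cylindersP[u _] := cylinders0 (X := X) S0.
  have -> : setT = @cylinder R X T S u setT by [].
  by rewrite PE probability_setT.
(* [I] is convertible to the type on which path probabilities live. *)
pose I := g_sigma_algebraType (@measurable _ (cylinder_space X S0)).
pose PM : {measure set I -> \bar R} := measure_extension m.
pose PP : probability I R := HB.pack (PM : set I -> \bar R) PM
  (Measure_isProbability.Build _ _ _ PM PT).
by exists PP.
Qed.

Section Necessity.
Context (P : path_probability X S) (Pmu : extends P mu).

Lemma cylinder_measurable C :
  cylinders X S C -> measurable (C : set (g_sigma_algebraType (cylinders X S))).
Proof. exact: sub_sigma_algebra. Qed.

Lemma extends_right_continuous : right_continuous_fdds mu.
Proof.
move=> t St tS; have FF := later_nbhs_filter S t.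
apply/fine_cvgP; split; first by apply: nearW => r; rewrite fin_num_measure.
apply/cvgrPdist_lt => e e0.
have E (r : later S t) : fine (mu (pair_grid St r) (agree t (val r))) =
    1 - fine (P [set w | val w t <> val w (val r)]).
  have -> : [set w | val w t <> val w (val r)] =
    cylinder (u := pair_grid St r) (~` agree t (val r)) by [].
  rewrite Pmu probability_setC// fineB ?fin_num_measure//.
  by rewrite subKr.
have mne (r : later S t) : measurable
    ([set w | val w t <> val w (val r)] :
       set (g_sigma_algebraType (cylinders X S))).
  by apply: cylinder_measurable; exists (pair_grid St r), (~` agree t (val r)).
(* Otherwise the event that the values at [t] and [r] differ has probability
   at least [e] for a sequence of times [r] tending to [t], whereas each path
   takes the value at [t] at all but finitely many of them. *)
apply: contrapT => nnear.
have /choice[r_ rP] : forall n : nat, exists r : later S t,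
    val (val r) < val t + n.+1%:R^-1 /\
    (e%:E <= P [set w | val w t <> val w (val r)])%E.
  move=> n; apply: contrapT => none; apply: nnear.
  exists n.+1%:R^-1 => [|r /= rn]; first by rewrite /= invr_gt0 ltr0n.
  rewrite E subKr ger0_norm ?fine_ge0//.
  have Pfin := fin_num_measure P _ (mne r).
  rewrite -lte_fin fineK// ltNge; apply/negP => le.
  by apply: none; exists r.
pose A n : set (g_sigma_algebraType (cylinders X S)) :=
  [set w | val w t <> val w (val (r_ n))].
have [||N _ /(_ N (leqnn N))] := probability_lim_sup_empty P (A := A) _ _ e0.
- by move=> n; exact: mne.
- move=> w; have [_ _ wr] := set_mem (valP w).
  have tT : rlims T (val t).
    by move=> d d0; have [r _ tr] := rlims_ex tS d0; exists (val r); split;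
      [rewrite /= in_itv|exact/set_mem/(valP r)].
  have [d d0 dw] := wr t tT.
  have [N Nd] := @ltr_add_invr R 0 d d0; rewrite add0r in Nd.
  exists N => n Nn; apply; apply/esym/dw.
  have [_ ->] := set_mem (valP (r_ n)).
  have [rn _] := rP n; rewrite (lt_trans rn)// ltrD2l (le_lt_trans _ Nd)//.
  by rewrite lef_pV2 ?posrE ?ltr0n// ler_nat ltnS.
- by rewrite ltNge; have [_ ->] := rP N.
Qed.

Lemma extends_bounded_jumps : bounded_jumps mu.
Proof.
move=> n n0 wn0.
set s_ := (fun k : nat => _).
have s_ge0 k : (0 <= s_ k)%E.
  have [t [tn St]] := wn0; have [||u uE] := @grid_of_seq R T S [:: t] => //.
    by move=> r; rewrite inE => /eqP->.
  apply: (@le_trans _ _ (mu u [set x | (k <= jumps x)%N])) => //.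
  apply: ereal_sup_ubound; exists u => //=; split.
  - exact: grid_neq0.
  - exact: grid_increasing.
  - by move=> r; rewrite uE inE => /eqP->.
have s_le1 k : (s_ k <= 1)%E.
  by apply: ge_ereal_sup => _ [u _ <-]; exact: probability_le1.
have s_fin k : s_ k \is a fin_num.
  by rewrite ge0_fin_numE// (le_lt_trans (s_le1 k))// ltry.
apply/fine_cvgP; split; first exact: nearW.
apply/cvgrPdist_lt => e e0.
(* Grids that nearly attain the suprema; a path lies in only finitely many of
   the corresponding events, namely in none beyond its number of jumps. *)
have P_lt k : exists u, grid (@window R T S n) (val u) /\
    (s_ k - (e / 2)%:E < mu u [set x | (k <= jumps x)%N])%E.
  have e2 : 0 < e / 2 by rewrite divr_gt0.
  by have [_ [u gu <-]] := ub_ereal_sup_adherent e2 (s_fin k); exists u.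
have /choice[u_ uP] := P_lt.
pose A k : set (g_sigma_algebraType (cylinders X S)) :=
  [set w | (k <= changes (map (val w) (val (u_ k))))%N].
have AE k : A k = cylinder (u := u_ k) [set x | (k <= jumps x)%N].
  have uu : uniq (val (u_ k)) by rewrite increasing_uniq// grid_increasing.
  by apply/seteqP; split=> w; rewrite /cylinder/= [jumps _]jumps_changes.
have [|||N _ NA] := probability_lim_sup_empty P (A := A) (e := e / 2).
- move=> k; apply: cylinder_measurable; rewrite AE.
  by exists (u_ k), [set x | (k <= jumps x)%N].
- move=> w.
  have [K bK] := cadlag_locally_bounded_changes (valP w) (- n%:R) n%:R.
  exists K.+1 => k Kk /(leq_trans Kk); rewrite ltnNge => /negP; apply.
  apply: bK => [|t tu]; first exact: grid_increasing.
  by have [[_ _ /(_ t tu)[tn _]] _] := uP k.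
- by rewrite divr_gt0.
exists N => // k /= Nk; rewrite sub0r normrN ger0_norm ?fine_ge0//.
have [_ s_lt] := uP k; rewrite -Pmu -AE in s_lt.
have := lt_trans s_lt (NA k Nk).
by rewrite -{1}(fineK (s_fin k)) -EFinB lte_fin ltrBlDr -splitr.
Qed.

End Necessity.

Lemma extends_unique (P Q : path_probability X S) : S !=set0 ->
  extends P mu -> extends Q mu -> forall B : set (paths X T),
  (cylinders X S).-sigma.-measurable B -> P B = Q B.
Proof.
move=> S0 Pmu Qmu; have c0 := cylinders0 (X := X) S0.
apply: (@g_sigma_algebra_measure_unique _ _
  (g_sigma_algebraType (cylinders X S)) (cylinders X S) _ (fun=> setT)).
- by move=> C; exact: sub_sigma_algebra.
- by move=> _; rewrite -setC0; exact: cylindersC.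
- by apply/seteqP; split=> // w _; exists 0%N.
- by move=> C1 C2; exact: cylindersI.
- by move=> _ [u [A ->]]; transitivity (mu u A); [exact: Pmu|exact/esym/Qmu].
- by move=> _; apply: le_lt_trans (probability_le1 P measurableT) (ltry _).
Qed.

End Extension.

Theorem theorem11 (R : realType) (X : pointedType) (T : set R) (S : set T)
    (mu : fdds X S) :
  countable [set: X] -> infinite_set T -> S !=set0 -> consistent mu ->
  ((exists P : path_probability X S, extends P mu) <-> regular mu) /\
  (forall P Q : path_probability X S, extends P mu -> extends Q mu ->
   forall B : set (paths X T),
     (cylinders X S).-sigma.-measurable B -> P B = Q B).
Proof.
move=> Xc _ S0 muc; split; last by move=> P Q; exact: extends_unique.
split=> [[P Pmu]|mur]; last exact: regular_extends.
split; [exact: extends_right_continuous Pmu|exact: extends_bounded_jumps Pmu].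
Qed.
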